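(* Let $\mathbb{F}$ be a division ring, $n$ a positive integer, $\sigma:\mathbb{F}\to\mathbb{F}^{n\times n}$ a ring morphism, $\delta:\mathbb{F}\to\mathbb{F}^n$ a $\sigma$-derivation and $\mathbf{a}\in\mathbb{F}^n$. The P-Galois extension $K_{\mathbf{a}}\subseteq\mathbb{F}$ is finite if, and only if, $\mathbb{F}[\mathcal{D}_{\mathbf{a}}]$ has finite left dimension over $\mathbb{F}$, in which case the latter dimension coincides with $\dim^R_{K_{\mathbf{a}}}(\mathbb{F})$. In particular, $K_{\mathbf{a}}\subseteq\mathbb{F}$ is finite if the set of maps $\mathcal{D}_{\mathbf{a}}^{\mathcal{M}}=\{\mathcal{D}_{\mathbf{a}}^{\mathfrak{m}}\mid\mathfrak{m}\in\mathcal{M}\}$ is finite, and in that case $$\dim^R_{K_{\mathbf{a}}}(\mathbb{F})\leq\left|\mathcal{D}_{\mathbf{a}}^{\mathcal{M}}\right|.$$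
   Context: Rings are associative with identity, not necessarily commutative, and ring morphisms preserve identities. $\mathbb{F}^n$ denotes column vectors. A map $\delta:\mathbb{F}\to\mathbb{F}^n$ is a $\sigma$-derivation if $\delta(a+b)=\delta(a)+\delta(b)$ and $\delta(ab)=\sigma(a)\delta(b)+\delta(a)b$ for all $a,b\in\mathbb{F}$. Linearized polynomials: let $\mathcal{M}$ be the free monoid on variables $x_1,\dots,x_n$. Define $\mathcal{D}_{\mathbf{a}}:\mathbb{F}\to\mathbb{F}^n$ by $\mathcal{D}_{\mathbf{a}}(\beta)=\sigma(\beta)\mathbf{a}+\delta(\beta)$. Define maps $\mathcal{D}_{\mathbf{a}}^{\mathfrak{m}}:\mathbb{F}\to\mathbb{F}$ for $\mathfrak{m}\in\mathcal{M}$ recursively by $\mathcal{D}_{\mathbf{a}}^{1}=\mathrm{Id}$ and $\mathcal{D}_{\mathbf{a}}^{x_i\mathfrak{m}}(\beta)=$ the $i$-th component of $\mathcal{D}_{\mathbf{a}}(\mathcal{D}_{\mathbf{a}}^{\mathfrak{m}}(\beta))$. $\mathbb{F}[\mathcal{D}_{\mathbf{a}}]$ is the left $\mathbb{F}$-vector space of maps $\mathbb{F}\to\mathbb{F}$ generated by $\{\mathcal{D}_{\mathbf{a}}^{\mathfrak{m}}\mid\mathfrak{m}\in\mathcal{M}\}$. Centralizer: $K_{\mathbf{a}}=\{\beta\in\mathbb{F}\mid\mathcal{D}_{\mathbf{a}}(\beta)=\mathbf{a}\beta\}$, a division subring of $\mathbb{F}$. $\dim^R_K$ denotes right dimension over $K$.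 P-Galois extensions: a pair $K\subseteq\mathbb{F}$ with $K$ a division subring is a P-Galois extension if $K=K_{\mathbf{a}}$ for some positive integer $n$, some ring morphism $\sigma:\mathbb{F}\to\mathbb{F}^{n\times n}$, some $\sigma$-derivation $\delta$ and some $\mathbf{a}\in\mathbb{F}^n$. It is finite if the right dimension of $\mathbb{F}$ over $K$ is finite. *)

(* Defs.v *)
From HB Require Import structures.
From mathcomp Require Import all_boot all_algebra.
From mathcomp Require Import boolp classical_sets functions cardinality.

Set Implicit Arguments.
Unset Strict Implicit.
Unset Printing Implicit Defensive.

Import GRing.Theory.
Local Open Scope classical_set_scope.
Local Open Scope ring_scope.

(* [GRing.field_axiom] says that nonzero elements are units; commutativity is
   not part of it. *)
Definition division_ring (F : unitRingType) : Prop := GRing.field_axiom F.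

Section LeftDimension.
Variables (R : pzRingType) (V : lmodType R).

Definition lspan (S : set V) : set V :=
  [set v | exists (m : nat) (c : 'I_m -> R) (s : 'I_m -> V),
     (forall i, S (s i)) /\ v = \sum_(i < m) c i *: s i].

Definition left_basis (U : set V) (d : nat) (b : 'I_d -> V) : Prop :=
  [/\ forall i, U (b i),
      forall c : 'I_d -> R, \sum_(i < d) c i *: b i = 0 -> forall i, c i = 0
    & forall v, U v -> exists c : 'I_d -> R, v = \sum_(i < d) c i *: b i].

Definition has_left_dim (U : set V) (d : nat) : Prop :=
  exists b : 'I_d -> V, left_basis U b.

Definition finite_left_dim (U : set V) : Prop := exists d, has_left_dim U d.

End LeftDimension.

Section RightDimension.
Variables (F : unitRingType) (K : {pred F}).

Definition right_basis (d : nat) (b : 'I_d -> F) : Prop :=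
  (forall c : 'I_d -> F, (forall i, c i \in K) ->
     \sum_(i < d) b i * c i = 0 -> forall i, c i = 0) /\
  (forall x : F, exists c : 'I_d -> F,
     (forall i, c i \in K) /\ x = \sum_(i < d) b i * c i).

Definition has_right_dim (d : nat) : Prop := exists b : 'I_d -> F, right_basis b.

Definition finite_right_dim : Prop := exists d, has_right_dim d.

End RightDimension.

(* MathComp's [*:] on columns is scaling on the left; this is v b. *)
Definition rscale (F : unitRingType) (n : nat) (v : 'cV[F]_n) (b : F) : 'cV[F]_n :=
  \col_i (v i 0 * b).

Definition sigma_derivation (F : unitRingType) (n : nat)
    (sigma : F -> 'M[F]_n) (delta : F -> 'cV[F]_n) : Prop :=
  (forall a b, delta (a + b) = delta a + delta b) /\
  (forall a b, delta (a * b) = sigma a *m delta b + rscale (delta a) b).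

Section Operators.
Variables (F : unitRingType) (n : nat).
Variables (sigma : F -> 'M[F]_n) (delta : F -> 'cV[F]_n) (a : 'cV[F]_n).

Definition Dop (beta : F) : 'cV[F]_n := sigma beta *m a + delta beta.

(* The free monoid on x_1, ..., x_n is [seq 'I_n]: the head of the word is its
   leftmost letter. The codomain is the regular module [F^o], so that maps
   F -> F carry the pointwise left F-module structure. *)
Fixpoint Dword (m : seq 'I_n) : F -> F^o :=
  if m is i :: m' then fun beta => Dop (Dword m' beta) i 0 else id.

Definition Dwords : set (F -> F^o) := range Dword.

Definition Dspace : set (F -> F^o) := lspan Dwords.

Definition centralizer : {pred F} := [pred beta | Dop beta == rscale a beta].

End Operators.

Definition PGalois (F : unitRingType) (K : {pred F}) : Prop :=
  divring_closed K /\
  exists (n : nat) (sigma : {rmorphism F -> 'M[F]_n}) (delta : F -> 'cV[F]_n)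
      (a : 'cV[F]_n),
    [/\ (0 < n)%N, sigma_derivation sigma delta & K =i centralizer sigma delta a].

Definition finite_PGalois (F : unitRingType) (K : {pred F}) : Prop :=
  PGalois K /\ finite_right_dim K.

(* Main.v *)
Require Import Defs.
From HB Require Import structures.
From mathcomp Require Import all_boot all_algebra.
From mathcomp Require Import boolp classical_sets functions cardinality.
Set Implicit Arguments.
Unset Strict Implicit.
Unset Printing Implicit Defensive.
Import GRing.Theory.
Local Open Scope classical_set_scope.
Local Open Scope ring_scope.

(** The left [F]-space [F[D_a]] is closed under composition with the [D_i], and
    it consists of right [K_a]-linear maps. Call [b_1, ..., b_m] in [F] and
    [phi_1, ..., phi_m] in [F[D_a]] dual if [phi_i (b_j)] is the Kronecker
    delta. As in the proof of Jacobson's density theorem, if every operator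
    vanishing at all the [b_j] also vanishes at [x], then
    [psi x = \sum_l psi (b_l) * phi_l x] for all operators [psi]; taking
    [psi = D_i \o phi_l] shows that [phi_l x] is in [K_a], and taking
    [psi = id] shows that [x] is in the right [K_a]-span of the [b_l].
    So a dual pair extends until [b] spans [F] on the right over [K_a], at which
    point [phi] is a left basis of [F[D_a]]. *)

(** * Closure properties of left spans *)

Section LeftSpan.
Variables (R : pzRingType) (V : lmodType R).
Implicit Types S : set V.

Lemma lspan_gen S s : S s -> lspan S s.
Proof.
move=> Ss; exists 1%N, (fun=> 1), (fun=> s).
by split=> //; rewrite big_ord1 scale1r.
Qed.

Lemma lspanD S u v : lspan S u -> lspan S v -> lspan S (u + v).
Proof.
move=> [m1 [c1 [s1 [S1 ->]]]] [m2 [c2 [s2 [S2 ->]]]].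
exists (m1 + m2)%N,
  (fun i => match fintype.split i with inl j => c1 j | inr j => c2 j end),
  (fun i => match fintype.split i with inl j => s1 j | inr j => s2 j end); split.
  by move=> i; case: (fintype.split i).
rewrite big_split_ord /=; congr (_ + _); apply: eq_bigr => i _.
  by rewrite -[lshift _ _]/(unsplit (inl i)) unsplitK.
by rewrite -[rshift _ _]/(unsplit (inr i)) unsplitK.
Qed.

Lemma lspanZ S c v : lspan S v -> lspan S (c *: v).
Proof.
move=> [m [c1 [s [Ss ->]]]]; exists m, (fun i => c * c1 i), s; split=> //.
by rewrite scaler_sumr; apply: eq_bigr => i _; rewrite scalerA.
Qed.

Lemma lspan_comb S m (c : 'I_m -> R) (s : 'I_m -> V) :
  (forall i, lspan S (s i)) -> lspan S (\sum_(i < m) c i *: s i).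
Proof.
move=> Ss; elim/big_ind: _ => [|u v|i _]; last exact: lspanZ.
- by exists 0%N, (fun=> 0), (fun=> 0); split=> [[]//|]; rewrite big_ord0.
- exact: lspanD.
Qed.

End LeftSpan.

(** * Linear algebra and invariance of left dimension over a division ring *)

Section DivisionRing.
Variables (F : unitRingType) (hF : division_ring F).

(** Gaussian elimination by induction on the number of columns: a zero first column is dropped;
    otherwise a pivot row [p] clears it, and a kernel row of the reduced matrix lifts to one of
    [A]. *)
Lemma left_kernel_neq0 d m (A : 'M[F]_(m, d)) : (d < m)%N ->
  exists2 c : 'rV[F]_m, c != 0 & c *m A = 0.
Proof.
elim: d m A => [|d IH] [//|m] A lt_dm.
  exists (const_mx 1); last by apply/rowP => -[].
  by apply/eqP => /rowP/(_ 0); rewrite !mxE => /eqP; rewrite oner_eq0.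
have [/existsP[p Ap0]|] := boolP [exists p, A p 0 != 0]; last first.
  rewrite negb_exists => /forallP A0.
  have [c c0 cA] := IH _ (col' 0 A) (ltnW lt_dm).
  exists c => //; apply/rowP => j; rewrite !mxE.
  case: (unliftP 0 j) => [k ->|->].
    move/rowP/(_ k): cA; rewrite !mxE => cAk.
    rewrite -[RHS]cAk; apply: eq_bigr => i _; by rewrite !mxE.
  by rewrite big1 // => i _; move/negPn/eqP: (A0 i) => ->; rewrite mulr0.
have Ap : A p 0 \is a GRing.unit by apply: hF.
have [c c0 cB] := IH m (\matrix_(k, j)
  (A (lift p k) (lift 0 j) - A (lift p k) 0 / A p 0 * A p (lift 0 j))) lt_dm.
(* The coefficient of the pivot row is forced by the vanishing of the product in column 0; the other
   columns then reduce to [cB]. *)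
pose t := - (\sum_k c 0 k * A (lift p k) 0) / A p 0.
pose e := \row_k (if unlift p k is Some k' then c 0 k' else t).
have ep : e 0 p = t by rewrite mxE unlift_none.
have el k : e 0 (lift p k) = c 0 k by rewrite mxE liftK.
exists e.
  apply: contra_neq c0 => /rowP e0; apply/rowP => k.
  by rewrite -el e0 !mxE.
apply/rowP => j; rewrite !mxE (bigD1_ord p) //= ep.
under eq_bigr do rewrite el.
case: (unliftP 0 j) => [k ->|->]; last by rewrite /t mulrVK // addNr.
move/rowP/(_ k): cB; rewrite !mxE => cBk; rewrite -[RHS]cBk.
rewrite /t 2!mulNr !mulr_suml -sumrN -big_split /=; apply: eq_bigr => i _.
by rewrite !mxE mulrBr addrC !mulrA.
Qed.

(** If [d < m], the coefficient matrix of the [v i] in the [s j] has a nonzero left kernel row,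
    which is a nontrivial relation among the [v i]. *)
Lemma left_free_leq (V : lmodType F) d m (s : 'I_d -> V) (v : 'I_m -> V) :
  (forall c : 'I_m -> F, \sum_(i < m) c i *: v i = 0 -> forall i, c i = 0) ->
  (forall i, exists c : 'I_d -> F, v i = \sum_(j < d) c j *: s j) ->
  (m <= d)%N.
Proof.
move=> v_free /choice[A vA]; rewrite leqNgt; apply/negP => lt_dm.
have [c /eqP c0 cA] := left_kernel_neq0 (\matrix_(i, j) A i j) lt_dm.
apply: c0; apply/rowP => i; rewrite mxE; apply: (v_free (fun i => c 0 i)).
under eq_bigr do rewrite vA scaler_sumr.
rewrite exchange_big big1 //= => j _.
under eq_bigr do rewrite scalerA.
rewrite -scaler_suml; move/rowP/(_ j): cA; rewrite !mxE => cA.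
rewrite -[RHS](scale0r (s j)); congr (_ *: _); rewrite -[RHS]cA.
by apply: eq_bigr => k _; rewrite mxE.
Qed.

Lemma has_left_dim_inj (V : lmodType F) (U : set V) d d' :
  has_left_dim U d -> has_left_dim U d' -> d = d'.
Proof.
move=> [b [bU b_free b_gen]] [b' [b'U b'_free b'_gen]].
apply/eqP; rewrite eqn_leq; apply/andP; split.
  by apply: (left_free_leq b_free) => i; apply: b'_gen.
by apply: (left_free_leq b'_free) => i; apply: b_gen.
Qed.

End DivisionRing.

Lemma fct_combE (F : unitRingType) m (c : 'I_m -> F) (s : 'I_m -> F -> F^o) x :
  (\sum_(i < m) c i *: s i) x = \sum_(i < m) c i * s i x.
Proof. exact: (big_morph (fun f : F -> F^o => f x)). Qed.

(** * The operators of [F[D_a]] and their right linearity over [K_a] *)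

Section Duality.
Variables (F : unitRingType) (hF : division_ring F) (n : nat).
Variables (sigma : {rmorphism F -> 'M[F]_n}) (delta : F -> 'cV[F]_n).
Variables (hdelta : sigma_derivation sigma delta) (a : 'cV[F]_n).

Local Notation D := (Dop sigma delta a).
Local Notation W := (Dword sigma delta a).
Local Notation U := (Dspace sigma delta a).
Local Notation K := (centralizer sigma delta a).

Lemma DopD x y : D (x + y) = D x + D y.
Proof. by rewrite /Dop rmorphD mulmxDl hdelta.1 addrACA. Qed.

Lemma Dop0 : D 0 = 0.
Proof. by apply: (@addrI _ (D 0)); rewrite -DopD !addr0. Qed.

Lemma Dop_sum m (f : 'I_m -> F) : D (\sum_(i < m) f i) = \sum_(i < m) D (f i).
Proof. exact: (big_morph _ DopD Dop0). Qed.

Lemma DopM x y : D (x * y) = sigma x *m D y + rscale (delta x) y.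
Proof. by rewrite /Dop rmorphM hdelta.2 mulmxDr mulmxA addrA. Qed.

(** The product rule at [1 * 1] gives [delta 1 = delta 1 + delta 1], so [delta 1 = 0]. *)
Lemma Dop1 : D 1 = a.
Proof.
have /eqP := hdelta.2 1 1; rewrite rmorph1 mul1mx mulr1 -subr_eq0 opprD.
rewrite addNKr oppr_eq0 => /eqP delta1.
rewrite /Dop rmorph1 mul1mx -[RHS]addr0; congr (_ + _).
by apply/colP => i; move/colP/(_ i): delta1; rewrite !mxE mulr1.
Qed.

Lemma centralizerP y : reflect (D y = rscale a y) (y \in K).
Proof. exact: eqP. Qed.

Lemma DopMK x y : y \in K -> D (x * y) = rscale (D x) y.
Proof.
move/centralizerP => Dy; rewrite DopM Dy; apply/colP => i.
rewrite !mxE mulrDl mulr_suml; congr (_ + _).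
by apply: eq_bigr => j _; rewrite !mxE mulrA.
Qed.

Lemma rscaleA (v : 'cV[F]_n) x y : rscale (rscale v x) y = rscale v (x * y).
Proof. by apply/colP => i; rewrite !mxE mulrA. Qed.

(** Products and inverses both come from [DopMK]; for a nonzero [y] in [K] it gives [D y^-1] times
    [y] equal to [D 1 = a]. *)
Lemma centralizer_divring_closed : divring_closed K.
Proof.
have K1 : 1 \in K.
  by apply/centralizerP; rewrite Dop1; apply/colP => i; rewrite mxE mulr1.
have KM x y : x \in K -> y \in K -> x * y \in K.
  by move=> /centralizerP Dx Ky; apply/centralizerP; rewrite DopMK // Dx rscaleA.
have KB x y : x \in K -> y \in K -> x - y \in K.
  move=> /centralizerP Dx /centralizerP Dy; apply/centralizerP.
  apply: (@addIr _ (D y)); rewrite -DopD subrK Dx Dy; apply/colP => i.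
  by rewrite !mxE mulrBr subrK.
split=> // x y Kx Ky; apply: (KM _ _ Kx).
have [->|/hF y_unit] := eqVneq y 0; first by rewrite invr0 -(subrr 1) KB.
have Dy : rscale (D y^-1) y = a by rewrite -DopMK // mulVr // Dop1.
apply/centralizerP; rewrite -[a in RHS]Dy rscaleA divrr //.
by apply/colP => i; rewrite [RHS]mxE mulr1.
Qed.

Lemma DwordMK w x y : y \in K -> W w (x * y) = W w x * y.
Proof. by move=> Ky; elim: w => [|i w /= ->] //; rewrite DopMK // mxE. Qed.

Lemma DwordD w x y : W w (x + y) = W w x + W w y.
Proof. by elim: w => [|i w /= ->] //; rewrite DopD mxE. Qed.

Lemma DspaceMK f x y : U f -> y \in K -> f (x * y) = f x * y.
Proof.
move=> [m [c [s [sW ->]]]] Ky; rewrite !fct_combE mulr_suml.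
by apply: eq_bigr => i _; have [w _ <-] := sW i; rewrite DwordMK // mulrA.
Qed.

Lemma DspaceD f x y : U f -> f (x + y) = f x + f y.
Proof.
move=> [m [c [s [sW ->]]]]; rewrite !fct_combE -big_split.
by apply: eq_bigr => i _; have [w _ <-] := sW i; rewrite DwordD mulrDr.
Qed.

Lemma Dspace0 f : U f -> f 0 = 0.
Proof. by move=> Uf; apply: (@addrI _ (f 0)); rewrite -DspaceD // !addr0. Qed.

Lemma Dspace_comb f m (b c : 'I_m -> F) : U f -> (forall i, c i \in K) ->
  f (\sum_(i < m) b i * c i) = \sum_(i < m) f (b i) * c i.
Proof.
move=> Uf cK; rewrite (big_morph f (fun x y => DspaceD x y Uf) (Dspace0 Uf)).
by apply: eq_bigr => i _; rewrite DspaceMK.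
Qed.

Lemma Dspace_id : U id.
Proof. by apply: lspan_gen; exists [::]. Qed.

(** By the product rule, applying [D] to [c * s x] gives [sigma c *m D (s x)] plus [delta c] times
    [s x], whose entries are again left combinations of words. *)
Lemma Dspace_Dop f i : U f -> U (fun x => D (f x) i 0).
Proof.
move=> [m [c [s [sW ->]]]].
(* The outer scalar 1 only puts the sum in the shape required by [lspan_comb]. *)
have -> : (fun x => D ((\sum_(k < m) c k *: s k) x) i 0) =
    \sum_(k < m) 1 *:
      (\sum_(j < n) sigma (c k) i j *: ((fun x => D (s k x) j 0) : F -> F^o)
       + delta (c k) i 0 *: s k) :> (F -> F^o).
  apply/funext => x; rewrite !fct_combE Dop_sum summxE.
  apply: eq_bigr => k _; rewrite DopM mul1r.
  rewrite -[RHS]/((\sum_(j < n) _ *: _) x + _) fct_combE.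
  by rewrite !mxE.
apply: lspan_comb => k; have [w _ <-] := sW k.
apply: lspanD; last by apply/lspanZ/lspan_gen; exists w.
by apply: lspan_comb => j; apply: lspan_gen; exists (j :: w).
Qed.

(** * Dual pairs *)

Definition dual_pair m (b : 'I_m -> F) (phi : 'I_m -> F -> F^o) : Prop :=
  (forall i, U (phi i)) /\ (forall i j, phi i (b j) = (i == j)%:R).

(** The subtracted sum is the Lagrange interpolant of [f] at the points [b l]. *)
Lemma dual_pair_residue m (b : 'I_m -> F) phi (f : F -> F^o) j :
  dual_pair b phi -> (f - \sum_(l < m) f (b l) *: phi l) (b j) = 0.
Proof.
move=> [_ bphi]; rewrite
  -[LHS]/(f (b j) - (\sum_(l < m) f (b l) *: phi l) (b j)).
rewrite fct_combE (bigD1 j) //= bphi eqxx mulr1 big1 ?addr0 ?subrr // => l.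
by rewrite bphi => /negPf ->; rewrite mulr0.
Qed.

Lemma Dspace_residue m (b : 'I_m -> F) phi (f : F -> F^o) :
  dual_pair b phi -> U f -> U (f - \sum_(l < m) f (b l) *: phi l).
Proof.
move=> [phiU _] Uf; rewrite -scaleN1r.
by apply: lspanD => //; apply/lspanZ/lspan_comb.
Qed.

Lemma span_or_separate m (b : 'I_m -> F) phi x : dual_pair b phi ->
  (exists c : 'I_m -> F, (forall i, c i \in K) /\ x = \sum_(i < m) b i * c i)
  \/ (exists theta, [/\ U theta, forall j, theta (b j) = 0 & theta x = 1]).
Proof.
move=> bphi; have [phiU bphiE] := bphi.
have [[f [Uf fb /eqP fx]]|sep] :=
    pselect (exists f, [/\ U f, forall j, f (b j) = 0 & f x <> 0]).
  right; exists ((f x)^-1 *: f); split; first exact: lspanZ.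
    by move=> j; rewrite -[LHS]/((f x)^-1 * f (b j)) fb mulr0.
  by rewrite -[LHS]/((f x)^-1 * f x) mulVr //; apply: hF.
left; exists (fun l => phi l x).
have psiE f : U f -> f x = \sum_(l < m) f (b l) * phi l x.
  move=> Uf; apply/eqP; rewrite -subr_eq0 -fct_combE; apply: contra_notT sep => fx.
  exists (f - \sum_(l < m) f (b l) *: phi l); split; last exact/eqP.
    exact: Dspace_residue.
  by move=> j; apply: dual_pair_residue.
split; last by rewrite {1}(psiE _ Dspace_id).
move=> l; apply/centralizerP/colP => i; rewrite [RHS]mxE /=.
(* The operator [D_i \o phi l] takes the value [D_i 1 = a_i] at [b l] and [D_i 0 = 0] at the other
   [b k], so only the term [a_i * phi l x] survives. *)
have /= -> := psiE _ (Dspace_Dop i (phiU l)); rewrite (bigD1 l) //= bphiE eqxx Dop1.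
rewrite big1 ?addr0 // => k; rewrite eq_sym bphiE => /negPf ->.
by rewrite Dop0 mxE mul0r.
Qed.

Definition rcons_fun T m (f : 'I_m -> T) (y : T) (i : 'I_m.+1) : T :=
  if unlift ord_max i is Some j then f j else y.

Lemma rcons_fun_lift T m (f : 'I_m -> T) y j :
  rcons_fun f y (lift ord_max j) = f j.
Proof. by rewrite /rcons_fun liftK. Qed.

Lemma rcons_fun_max T m (f : 'I_m -> T) y : rcons_fun f y ord_max = y.
Proof. by rewrite /rcons_fun unlift_none. Qed.

(** As in Gram-Schmidt, subtracting [phi i x *: theta] makes [phi i] vanish at [x] without changing
    it on the [b j]. *)
Lemma dual_pair_extend m (b : 'I_m -> F) phi x theta : dual_pair b phi ->
  U theta -> (forall j, theta (b j) = 0) -> theta x = 1 ->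
  exists phi', dual_pair (rcons_fun b x) phi'.
Proof.
move=> [phiU bphi] Ut tb tx.
exists (rcons_fun (fun i => phi i + (- phi i x : F) *: theta) theta); split.
  move=> i; case: (unliftP ord_max i) => [k ->|->].
    by rewrite rcons_fun_lift; apply: lspanD; [exact: phiU | exact: lspanZ].
  by rewrite rcons_fun_max.
move=> i j; case: (unliftP ord_max i) => [k ->|->];
  case: (unliftP ord_max j) => [l ->|->];
  rewrite ?rcons_fun_lift ?rcons_fun_max ?eqxx //.
- by rewrite -[LHS]/(phi k (b l) + - phi k x * theta (b l)) tb mulr0 addr0 bphi
             (inj_eq lift_inj).
- rewrite -[LHS]/(phi k x + - phi k x * theta x) tx mulr1 subrr.
  by rewrite eq_sym (negPf (neq_lift _ _)).
- by rewrite tb (negPf (neq_lift _ _)).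
Qed.

Lemma dual_pair_lfree m (b : 'I_m -> F) phi : dual_pair b phi ->
  forall c : 'I_m -> F, \sum_(i < m) c i *: phi i = 0 -> forall i, c i = 0.
Proof.
move=> [_ bphiE] c c0 i; move: (congr1 (fun f : F -> F^o => f (b i)) c0) => /=.
rewrite fct_combE (bigD1 i) //= bphiE eqxx mulr1 big1 ?addr0 // => l.
by rewrite bphiE => /negPf ->; rewrite mulr0.
Qed.

Lemma dual_pair_rfree m (b : 'I_m -> F) phi : dual_pair b phi ->
  forall c : 'I_m -> F, (forall i, c i \in K) ->
    \sum_(i < m) b i * c i = 0 -> forall i, c i = 0.
Proof.
move=> [phiU bphi] c cK c0 i; have := Dspace_comb b (phiU i) cK.
rewrite c0 Dspace0 // (bigD1 i) //= bphi eqxx mul1r big1 ?addr0 // => l.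
by rewrite eq_sym bphi => /negPf ->; rewrite mul0r.
Qed.

Lemma dual_pair_leq m d (b : 'I_m -> F) phi (s : 'I_d -> F -> F^o) :
  dual_pair b phi ->
  (forall f, U f -> exists c : 'I_d -> F, f = \sum_(i < d) c i *: s i) ->
  (m <= d)%N.
Proof.
by move=> bphi s_gen; apply: (left_free_leq hF (dual_pair_lfree bphi)) => i;
  apply/s_gen/bphi.1.
Qed.

(** * Bases and bounds obtained from dual pairs *)

Lemma bounded_finite_right_dim d :
  (forall m (b : 'I_m -> F) phi, dual_pair b phi -> (m <= d)%N) ->
  finite_right_dim K.
Proof.
move=> le_d.
pose P m := `[< exists (b : 'I_m -> F) phi, dual_pair b phi >].
have P0 : exists m, P m.
  by exists 0%N; apply/asboolP; exists (fun=> 0), (fun=> id); split=> -[].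
have Pd m : P m -> (m <= d)%N by move/asboolP => [b [phi /le_d]].
(* In a dual pair of maximal length, an [x] outside the right span of [b] would allow an
   extension. *)
case: (ex_maxnP P0 Pd) => m /asboolP[b [phi bphi]] max_m.
exists m, b; split; first exact: dual_pair_rfree bphi.
move=> x; have [//|[theta [Ut tb tx]]] := span_or_separate x bphi.
have [phi' bphi'] := dual_pair_extend bphi Ut tb tx.
have /max_m : P m.+1 by apply/asboolP; exists (rcons_fun b x), phi'.
by rewrite ltnn.
Qed.

Lemma centralizerN1 : -1 \in K.
Proof.
have [K1 KB _] := centralizer_divring_closed.
by rewrite -sub0r KB // -(subrr 1) KB.
Qed.

(** Induction on [m]: by freeness the last vector is outside the span of the others, hence separated
    from them by an operator that extends the dual pair. *)
Lemma right_free_dual_pair m (b : 'I_m -> F) :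
  (forall c : 'I_m -> F, (forall i, c i \in K) ->
     \sum_(i < m) b i * c i = 0 -> forall i, c i = 0) ->
  exists phi, dual_pair b phi.
Proof.
elim: m b => [|m IH] b b_free; first by exists (fun=> id); split=> -[].
have [K1 KB _] := centralizer_divring_closed.
pose b' i := b (lift ord_max i).
have [c cK c0|phi bphi] := IH b'.
  move=> i; rewrite -(rcons_fun_lift c 0); apply: b_free.
    move=> j; case: (unliftP ord_max j) => [k ->|->].
      by rewrite rcons_fun_lift.
    by rewrite rcons_fun_max -(subrr 1) KB.
  rewrite (bigD1_ord ord_max) //= rcons_fun_max mulr0 add0r -[RHS]c0.
  by apply: eq_bigr => k _; rewrite rcons_fun_lift.
have bE : b = rcons_fun b' (b ord_max).
  apply/funext => j; case: (unliftP ord_max j) => [k ->|->].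
    by rewrite rcons_fun_lift.
  by rewrite rcons_fun_max.
have [[c [cK bc]]|[theta [Ut tb tx]]] := span_or_separate (b ord_max) bphi.
  suff /eqP : (-1 : F) = 0 by rewrite oppr_eq0 oner_eq0.
  (* Moving the last vector to the other side gives a relation with last coefficient -1, which
     freeness forces to be 0. *)
  rewrite -(rcons_fun_max c (-1)); apply: b_free.
    move=> j; case: (unliftP ord_max j) => [k ->|->].
      by rewrite rcons_fun_lift.
    by rewrite rcons_fun_max centralizerN1.
  rewrite (bigD1_ord ord_max) //= rcons_fun_max mulrN1 bc.
  under [X in _ + X]eq_bigr do rewrite rcons_fun_lift.
  by rewrite addNr.
by rewrite bE; exact: (dual_pair_extend bphi Ut tb tx).
Qed.

(** The operators dual to a right basis generate: [f] minus its interpolant is right [K]-linear and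
    vanishes on the basis, hence everywhere. *)
Lemma right_dim_left_dim d : has_right_dim K d -> has_left_dim U d.
Proof.
move=> [b [b_free b_gen]]; have [phi bphi] := right_free_dual_pair b_free.
exists phi; split; [exact: bphi.1 | exact: dual_pair_lfree bphi |].
move=> f Uf; exists (fun i => f (b i)); apply/eqP; rewrite -subr_eq0; apply/eqP.
apply/funext => x; have [c [cK ->]] := b_gen x.
rewrite Dspace_comb //; last exact: Dspace_residue.
by rewrite big1 // => i _; rewrite dual_pair_residue // mul0r.
Qed.

Lemma Dwords_card_gen m : (Dwords sigma delta a #= `I_m)%card ->
  exists s : 'I_m -> F -> F^o, forall f, U f ->
    exists c : 'I_m -> F, f = \sum_(i < m) c i *: s i.
Proof.
move=> card_W.
have W0 : Dwords sigma delta a != set0 by apply/set0P; exists id, [::].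
have [g _] := finite_set_bij W0 card_W (@subset_refl _ _).
pose s (i : 'I_m) := g i.
have Ws w : exists i, s i = W w.
  have [|i /= lt_im gi] := @surj _ _ _ _ g (W w); first by exists w.
  by exists (Ordinal lt_im).
exists s => f [k [c [v [vW ->]]]].
have /choice[r vr] i : exists j, s j = v i by have [w _ <-] := vW i; apply: Ws.
(* Several terms may involve the same operator; their coefficients are collected along the fibres of
   [r]. *)
exists (fun j => \sum_(i < k | r i == j) c i).
rewrite (partition_big r xpredT) //=; apply: eq_bigr => j _.
by rewrite scaler_suml; apply: eq_bigr => i /eqP <-; rewrite vr.
Qed.

Lemma centralizer_PGalois : (0 < n)%N -> PGalois K.
Proof.
move=> hn; split; first exact: centralizer_divring_closed.
by exists n, sigma, delta, a.
Qed.

End Duality.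

Theorem theorem11 (F : unitRingType) (hF : division_ring F)
    (n : nat) (hn : (0 < n)%N)
    (sigma : {rmorphism F -> 'M[F]_n}) (delta : F -> 'cV[F]_n)
    (hdelta : sigma_derivation sigma delta) (a : 'cV[F]_n) :
  [/\ finite_PGalois (centralizer sigma delta a) <->
        finite_left_dim (Dspace sigma delta a),
      forall d d' : nat,
        has_left_dim (Dspace sigma delta a) d ->
        has_right_dim (centralizer sigma delta a) d' -> d = d',
      finite_set (Dwords sigma delta a) ->
        finite_PGalois (centralizer sigma delta a)
    & forall d m : nat,
        (Dwords sigma delta a #= `I_m)%card ->
        has_right_dim (centralizer sigma delta a) d -> (d <= m)%N].
Proof.
have PG := centralizer_PGalois hF hdelta a hn.
split.
- split=> [[_ [d /(right_dim_left_dim hF hdelta)]]|]; first by exists d.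
  move=> [d [s [_ _ s_gen]]]; split=> //.
  apply: (@bounded_finite_right_dim _ hF _ _ _ hdelta _ d) => m b phi bphi.
  exact: dual_pair_leq bphi s_gen.
(* A right basis of length [d'] yields a left basis of length [d'], and left dimension is unique. *)
- move=> d d' Ud /(right_dim_left_dim hF hdelta).
  exact: (has_left_dim_inj hF Ud).
- move=> /finite_setP[m /Dwords_card_gen[s s_gen]]; split=> //.
  apply: (@bounded_finite_right_dim _ hF _ _ _ hdelta _ m) => k b phi bphi.
  exact: dual_pair_leq bphi s_gen.
(* A right basis of length [d] has [d] left independent dual operators in a space generated by [m]
   operators. *)
- move=> d m /Dwords_card_gen[s s_gen] [b [b_free _]].
  have [phi bphi] := right_free_dual_pair hF hdelta b_free.
  exact: dual_pair_leq bphi s_gen.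
Qed.
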